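(* Let $L_1<L_2$ be real numbers. For any function $\phi=\phi(\xi,\eta)\in C^\infty\big(\mathbb{R}\times(L_1,L_2)\big)$ with $\phi(\xi+2\pi,\eta)=\phi(\xi,\eta)$ for all $\xi\in\mathbb{R}$, $\eta\in(L_1,L_2)$, define $$u_e^{pp}(x)=\big(-\partial_2\phi(x_1+x_2,x_3),\ \partial_1\phi(x_1+x_2,x_3),\ 0\big).$$ Then $u=u_e^{pp}$ is a solution of the static incompressible Euler equations $(u\cdot\nabla)u+\nabla P=0$, $\nabla\cdot u=0$ in $\mathbb{R}^2\times(L_1,L_2)$ (for some scalar pressure $P$) with boundary condition $$\begin{aligned} &u(x_1+2\pi,x_2,x_3)=u(x_1,x_2,x_3),\quad u(x_1,x_2+2\pi,x_3)=u(x_1,x_2,x_3),\quad\forall(x_1,x_2)\in\mathbb{R}^2,\ x_3\in(L_1,L_2),\\ &u_3(x_1,x_2,x_3)\big|_{x_3=L_1}=u_3(x_1,x_2,x_3)\big|_{x_3=L_2}=0,\quad\forall(x_1,x_2)\in\mathbb{R}^2. \end{aligned}\qquad(\mathrm{BC})$$ Moreover the vorticity $\omega=\nabla\times u$ satisfies $\omega\perp u$ and $$\omega=\big(-\partial_1\partial_3\phi(x_1+x_2,x_3),\ -\partial_2\partial_3\phi(x_1+x_2,x_3),\ \{\partial_1^2+\partial_2^2\}\phi(x_1+x_2,x_3)\big).$$ Consequently the solution of the static incompressible Euler equations with boundary condition (BC) is non-unique, i.e. there are at least two distinct velocity fields solving this problem.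
   Context: Here $x=(x_1,x_2,x_3)$, $\nabla=(\partial_1,\partial_2,\partial_3)$, $\partial_j=\partial/\partial x_j$, and $\partial_j\phi(x_1+x_2,x_3)$ denotes the $x_j$-derivative of the composite function $x\mapsto\phi(x_1+x_2,x_3)$; $u_3$ is the third component of $u$. *)

(* Defs.v *)
From HB Require Import structures.
From mathcomp Require Import all_boot all_order all_algebra.
From mathcomp Require Import all_classical all_reals all_analysis.

Set Implicit Arguments.
Unset Strict Implicit.
Unset Printing Implicit Defensive.

Import Order.TTheory GRing.Theory Num.Theory.
Import numFieldNormedType.Exports.

Local Open Scope classical_set_scope.
Local Open Scope ring_scope.

(* Coordinates are numbered from 0: the mathematical index j is the element
   j - 1 of 'I_n, so that in dimension 3 the vertical index is 2 : 'I_3. *)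

Definition vec2 {R : realType} (a b : R) : 'rV[R]_2 :=
  \row_(i < 2) nth 0 [:: a; b] i.

Definition vec3 {R : realType} (a b c : R) : 'rV[R]_3 :=
  \row_(i < 3) nth 0 [:: a; b; c] i.

Definition partial {R : realType} {n : nat} (i : 'I_n) (f : 'rV[R]_n -> R)
    (x : 'rV[R]_n) : R :=
  'D_(delta_mx 0 i) f x.

Fixpoint Ck {R : realType} {n : nat} (k : nat) (U : set 'rV[R]_n)
    (f : 'rV[R]_n -> R) : Prop :=
  (forall x, U x -> {for x, continuous f}) /\
  if k is k'.+1 then
    forall i : 'I_n, (forall x, U x -> derivable f x (delta_mx 0 i)) /\
                     Ck k' U (partial i f)
  else True.

(* Meaningful for open U, which is the only case used below. *)
Definition smooth {R : realType} {n : nat} (U : set 'rV[R]_n)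
    (f : 'rV[R]_n -> R) : Prop :=
  forall k : nat, Ck k U f.

Definition slab {R : realType} {n : nat} (j : 'I_n) (L1 L2 : R) :
    set 'rV[R]_n :=
  [set x | L1 < x 0 j < L2].

Definition component {R : realType} {n m : nat} (u : 'rV[R]_n -> 'rV[R]_m)
    (i : 'I_m) (x : 'rV[R]_n) : R :=
  u x 0 i.

Definition dot {R : realType} {n : nat} (a b : 'rV[R]_n) : R :=
  \sum_(i < n) a 0 i * b 0 i.

Definition grad {R : realType} {n : nat} (P : 'rV[R]_n -> R) (x : 'rV[R]_n) :
    'rV[R]_n :=
  \row_(i < n) partial i P x.

Definition divergence {R : realType} {n : nat} (u : 'rV[R]_n -> 'rV[R]_n)
    (x : 'rV[R]_n) : R :=
  \sum_(i < n) partial i (component u i) x.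

(* (v . nabla) u *)
Definition advection {R : realType} {n : nat} (v u : 'rV[R]_n -> 'rV[R]_n)
    (x : 'rV[R]_n) : 'rV[R]_n :=
  \row_(i < n) \sum_(j < n) v x 0 j * partial j (component u i) x.

Definition curl {R : realType} (u : 'rV[R]_3 -> 'rV[R]_3) (x : 'rV[R]_3) :
    'rV[R]_3 :=
  vec3 (partial 1 (component u 2) x - partial 2 (component u 1) x)
       (partial 2 (component u 0) x - partial 0 (component u 2) x)
       (partial 0 (component u 1) x - partial 1 (component u 0) x).

(* Classical (C^1) solutions in an open set U. *)
Definition static_euler {R : realType} (U : set 'rV[R]_3)
    (u : 'rV[R]_3 -> 'rV[R]_3) (P : 'rV[R]_3 -> R) : Prop :=
  [/\ forall i : 'I_3, Ck 1 U (component u i),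
      Ck 1 U P,
      forall x, U x -> advection u u x + grad P x = 0 &
      forall x, U x -> divergence u x = 0].

(* u is a field on the open slab (its values elsewhere are irrelevant), so
   u_3 = 0 at x_3 = L1, L2 is read as: u_3 extends continuously by 0 from the
   open slab to these two planes. *)
Definition boundary_condition {R : realType} (L1 L2 : R)
    (u : 'rV[R]_3 -> 'rV[R]_3) : Prop :=
  [/\ forall x1 x2 x3 : R, L1 < x3 < L2 ->
        u (vec3 (x1 + 2 * pi) x2 x3) = u (vec3 x1 x2 x3),
      forall x1 x2 x3 : R, L1 < x3 < L2 ->
        u (vec3 x1 (x2 + 2 * pi) x3) = u (vec3 x1 x2 x3),
      forall x1 x2 : R,
        component u 2 @
          within (slab 2 L1 L2) (nbhs (vec3 x1 x2 L1)) --> (0 : R) &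
      forall x1 x2 : R,
        component u 2 @
          within (slab 2 L1 L2) (nbhs (vec3 x1 x2 L2)) --> (0 : R)].

Definition euler_slab_solution {R : realType} (L1 L2 : R)
    (u : 'rV[R]_3 -> 'rV[R]_3) : Prop :=
  (exists P : 'rV[R]_3 -> R, static_euler (slab 2 L1 L2) u P) /\
  boundary_condition L1 L2 u.

(* The composite x |-> phi (x_1 + x_2, x_3). *)
Definition lift_phi {R : realType} (phi : 'rV[R]_2 -> R) (x : 'rV[R]_3) : R :=
  phi (vec2 (x 0 0 + x 0 1) (x 0 2)).

Definition u_pp {R : realType} (phi : 'rV[R]_2 -> R) (x : 'rV[R]_3) :
    'rV[R]_3 :=
  vec3 (- partial 1 (lift_phi phi) x) (partial 0 (lift_phi phi) x) 0.

(* Main.v *)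
Require Import Defs.
From HB Require Import structures.
From mathcomp Require Import all_boot all_order all_algebra.
From mathcomp Require Import all_classical all_reals all_analysis.
From mathcomp Require Import ring lra.
Import Order.TTheory GRing.Theory Num.Theory.
Import numFieldNormedType.Exports.
Local Open Scope classical_set_scope.
Local Open Scope ring_scope.

(** Write [p] for the derivative of [phi] in its first variable.  Since [phi] is
    evaluated at [(x_1 + x_2, x_3)], the derivatives in [x_1] and in [x_2] of
    the composite both equal [p (x_1 + x_2, x_3)], so the field is the parallel
    flow [u = (- g, g, 0)] with [g x = p (x_1 + x_2, x_3)].  Its direction is
    the constant vector [(-1, 1, 0)], along which [x_1 + x_2] and [x_3], hence
    [g], do not vary.  Therefore [u . grad] annihilates every component of [u],
    [div u] vanishes, and the Euler equations hold with [P = 0]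
    ([static_euler_shear_flow]).  The condition on [u_3 = 0] is trivial, and the
    periodicity of [u] is inherited from that of [phi].

    A direct computation gives
    [curl u = (- d_3 g, - d_3 g, d_1 g + d_2 g)], whose scalar product with
    [(- g, g, 0)] is zero ([curl_shear_flow], [dot_curl_shear_flow]).  To write
    the first two entries as [- d_1 d_3] and [- d_2 d_3] of the composite, the
    mixed derivatives of [phi] have to be exchanged, which is Schwarz's theorem
    ([mixed_derivatives_commute]).

    Non-uniqueness follows by taking [phi = 0] and [phi = sin xi]. *)

(** * Directional derivatives and Schwarz's theorem *)

Section DirectionalDerivatives.
Context {R : realType}.

(** A directional derivative only sees the restriction of the function to a
    line.  Stated for two functions on two spaces, this one fact yields the
    chain rule along affine maps, the reduction to one variable, and the
    periodicity of derivatives, without any differentiability assumption. *)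
Lemma difference_quotient_along {U V W : normedModType R} (f : U -> W)
    (g : V -> W) (x v : U) (y w : V) :
  (forall h : R, f (h *: v + x) = g (h *: w + y)) ->
  (fun h : R => h^-1 *: ((f \o shift x) (h *: v) - f x)) =
  (fun h : R => h^-1 *: ((g \o shift y) (h *: w) - g y)).
Proof.
move=> fg; have fgxy : f x = g y by have := fg 0; rewrite !scale0r !add0r.
by apply/funext => h /=; rewrite fg fgxy.
Qed.

Lemma derivable_along {U V W : normedModType R} (f : U -> W) (g : V -> W)
    (x v : U) (y w : V) :
  (forall h : R, f (h *: v + x) = g (h *: w + y)) ->
  derivable f x v = derivable g y w.
Proof.
by move=> fg; rewrite /derivable (difference_quotient_along _ _ _ _ _ _ fg).
Qed.

Lemma derive_along {U V W : normedModType R} (f : U -> W) (g : V -> W)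
    (x v : U) (y w : V) :
  (forall h : R, f (h *: v + x) = g (h *: w + y)) -> 'D_v f x = 'D_w g y.
Proof.
by move=> fg; rewrite /derive (difference_quotient_along _ _ _ _ _ _ fg).
Qed.

Lemma is_derive_line {V : normedModType R} (f : V -> R) (x v : V) (s : R) :
  derivable f (x + s *: v) v ->
  is_derive s 1 (fun r : R => f (x + r *: v)) ('D_v f (x + s *: v)).
Proof.
move=> df; have fl (h : R) :
    (fun r : R => f (x + r *: v)) (h *: 1 + s) = f (h *: v + (x + s *: v)).
  by rewrite /= scalerDl /GRing.scale /= mulr1 addrCA.
by split; [rewrite (derivable_along _ _ _ _ _ _ fl)
          |rewrite (derive_along _ _ _ _ _ _ fl)].
Qed.

(** Two applications of the mean value theorem: to the increment of [f] in the
    direction [w], as a function of the position along [v], and then to ['D_v f]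
    along [w].  The left-hand side is symmetric in [v] and [w]. *)
Lemma second_difference_mvt {V : normedModType R} (f : V -> R) (v w x : V)
    (t : R) :
  0 < t ->
  (forall s r : R, 0 <= s <= t -> 0 <= r <= t ->
     derivable f (x + s *: v + r *: w) v /\
     derivable ('D_v f) (x + s *: v + r *: w) w) ->
  exists s r : R, [/\ 0 <= s <= t, 0 <= r <= t &
    f (x + t *: v + t *: w) - f (x + t *: v) - f (x + t *: w) + f x =
    t ^+ 2 * 'D_w ('D_v f) (x + s *: v + r *: w)].
Proof.
move=> t0 df.
have tI : 0 <= t <= t by rewrite (ltW t0) lexx.
have zI : 0 <= (0 : R) <= t by rewrite (ltW t0) lexx.
pose F (s : R) := f (x + t *: w + s *: v) - f (x + s *: v).
have dF (s : R) : 0 <= s <= t -> is_derive s 1 F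
    ('D_v f (x + t *: w + s *: v) - 'D_v f (x + s *: v)).
  move=> st; apply: is_deriveB; apply: is_derive_line.
    by rewrite addrAC; have [] := df _ _ st tI.
  by have [] := df _ _ st zI; rewrite scale0r addr0.
have [||s + Fs] := @MVT R F
    (fun s => 'D_v f (x + t *: w + s *: v) - 'D_v f (x + s *: v)) 0 t t0.
- by move=> s; rewrite in_itv/= => /andP[s0 s1]; apply: dF; rewrite !ltW.
- apply: derivable_within_continuous => s; rewrite in_itv/= => st.
  by have [] := dF _ st.
rewrite in_itv/= => /andP[s0 st].
have sI : 0 <= s <= t by rewrite !ltW.
have dG (r : R) : 0 <= r <= t ->
    is_derive r 1 (fun r => 'D_v f (x + s *: v + r *: w))
      ('D_w ('D_v f) (x + s *: v + r *: w)).
  by move=> rt; apply: is_derive_line; have [] := df _ _ sI rt.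
have [||r + Gr] := @MVT R (fun r => 'D_v f (x + s *: v + r *: w))
    (fun r => 'D_w ('D_v f) (x + s *: v + r *: w)) 0 t t0.
- by move=> r; rewrite in_itv/= => /andP[r0 r1]; apply: dG; rewrite !ltW.
- apply: derivable_within_continuous => r; rewrite in_itv/= => rt.
  by have [] := dG _ rt.
rewrite in_itv/= => /andP[r0 rt].
exists s, r; split; rewrite ?ltW//.
move: Fs Gr; rewrite /F !scale0r !addr0 !subr0 (addrAC x (t *: w) (s *: v)).
move=> + Gr; rewrite Gr (addrAC x (t *: w) (t *: v)) => Fs.
by rewrite expr2 mulrC -mulrA mulrC -mulrA in Fs *; lra.
Qed.

(** Schwarz's theorem.  By symmetry of the second difference, for every small
    [t] the two mixed derivatives take a common value at two points of the
    parallelogram spanned by [t v] and [t w] at [x]; continuity at [x] then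
    makes them equal there. *)
Lemma mixed_derivatives_commute {V : normedModType R} (f : V -> R) (v w x : V)
    (U : set V) :
  nbhs x U ->
  (forall y, U y -> [/\ derivable f y v, derivable f y w,
     derivable ('D_v f) y w & derivable ('D_w f) y v]) ->
  {for x, continuous ('D_w ('D_v f))} -> {for x, continuous ('D_v ('D_w f))} ->
  'D_w ('D_v f) x = 'D_v ('D_w f) x.
Proof.
move=> xU df cvw cwv; apply/eqP; rewrite -subr_eq0 -normr_le0.
apply/ler_addgt0Pr => _ /posnumP[e]; rewrite add0r.
have e2 : 0 < e%:num / 2 by [].
have /nbhs_ballP[d /= d0 dU] : nbhs x (U `&`
    ([set y | `|'D_w ('D_v f) x - 'D_w ('D_v f) y| < e%:num / 2] `&`
     [set y | `|'D_v ('D_w f) x - 'D_v ('D_w f) y| < e%:num / 2])).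
  apply: (filterI xU).
  apply: filterI; first exact: (cvgr_dist_lt _ _ cvw).
  exact: (cvgr_dist_lt _ _ cwv).
(* Small enough for the whole parallelogram to lie in the ball of radius [d];
   adding 1 covers the case [v = w = 0]. *)
pose t := d / (`|v| + `|w| + 1).
have n0 : 0 < `|v| + `|w| + 1 by rewrite ltr_wpDl// addr_ge0.
have t0 : 0 < t by rewrite divr_gt0.
have sq s r : 0 <= s <= t -> 0 <= r <= t -> ball x d (x + s *: v + r *: w).
  move=> /andP[s0 st] /andP[r0 rt].
  rewrite -ball_normE /ball_/= -addrA opprD addNKr normrN.
  apply: (le_lt_trans (ler_normD _ _)); rewrite !normrZ !ger0_norm//.
  have -> : d = t * (`|v| + `|w| + 1) by rewrite /t divfK// gt_eqF.
  apply: (@le_lt_trans _ _ (t * `|v| + t * `|w|)).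
    by rewrite lerD// ler_wpM2r.
  by rewrite -mulrDr ltr_pM2l// ltrDl.
have Usq s r : 0 <= s <= t -> 0 <= r <= t -> U (x + s *: v + r *: w).
  by move=> sI rI; have [Uy _] := dU _ (sq _ _ sI rI).
have [|s [r [sI rI E1]]] := second_difference_mvt f v w x t t0.
  by move=> s r sI rI; have [dv _ dvw _] := df _ (Usq _ _ sI rI).
have [|r' [s' [rI' sI' E2]]] := second_difference_mvt f w v x t t0.
  move=> r' s' rI' sI'; rewrite addrAC.
  by have [_ dw _ dwv] := df _ (Usq _ _ sI' rI').
have E : 'D_w ('D_v f) (x + s *: v + r *: w) =
         'D_v ('D_w f) (x + s' *: v + r' *: w).
  have t2 : t ^+ 2 != 0 by rewrite expf_neq0// gt_eqF.
  apply: (mulfI t2); rewrite -E1 (addrAC x (s' *: v)) -E2.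
  by rewrite (addrAC x (t *: v)); ring.
have [_ [/= A1 _]] := dU _ (sq _ _ sI rI).
have [_ [_ /= A2]] := dU _ (sq _ _ sI' rI').
rewrite E in A1; rewrite [e%:num]splitr.
apply: (le_trans (ler_distD ('D_v ('D_w f) (x + s' *: v + r' *: w)) _ _)).
by apply: lerD; [exact: (ltW A1)|rewrite distrC; exact: (ltW A2)].
Qed.

End DirectionalDerivatives.

(** * Composition with the map (x_1, x_2, x_3) -> (x_1 + x_2, x_3) *)

Section Shear.
Context {R : realType}.

Definition shear (x : 'rV[R]_3) : 'rV[R]_2 := vec2 (x 0 0 + x 0 1) (x 0 2).

(** The directions [e_1] and [e_2] of space both become the first direction of
    the plane: this is why the derivatives in [x_1] and [x_2] coincide. *)
Lemma shear_line (i : 'I_3) (h : R) (x : 'rV[R]_3) :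
  shear (h *: delta_mx 0 i + x) =
  h *: delta_mx 0 (if i == 2 then 1 else 0) + shear x.
Proof.
by case: i => -[|[|[|[]]]]// i; apply/rowP => -[[|[|[]]]// j];
  rewrite !mxE/=; ring.
Qed.

(** An equality of functions on the whole space, with no regularity assumption,
    so that it can be iterated for higher derivatives. *)
Lemma partial_lift_phi (f : 'rV[R]_2 -> R) (i : 'I_3) :
  partial i (lift_phi f) = lift_phi (partial (if i == 2 then 1 else 0) f).
Proof.
apply/funext => x; apply: derive_along => h.
by rewrite -[LHS]/(f (shear _)) shear_line.
Qed.

Lemma derivable_lift_phi (f : 'rV[R]_2 -> R) (i : 'I_3) (x : 'rV[R]_3) :
  derivable f (shear x) (delta_mx 0 (if i == 2 then 1 else 0)) ->
  derivable (lift_phi f) x (delta_mx 0 i).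
Proof.
have fl (h : R) : lift_phi f (h *: delta_mx 0 i + x) =
    f (h *: delta_mx 0 (if i == 2 then 1 else 0) + shear x).
  by rewrite -[LHS]/(f (shear _)) shear_line.
by move=> df; rewrite (derivable_along _ _ _ _ _ _ fl).
Qed.

Lemma continuous_row {T : topologicalType} n (g : T -> 'rV[R]_n) (x : T) :
  (forall j, {for x, continuous (fun y => g y 0 j)}) -> {for x, continuous g}.
Proof.
move=> gc A [P Px PA].
have : nbhs x [set y | forall j, P 0 j (g y 0 j)].
  by apply: filter_forall => j; exact: (gc j _ (Px 0 j)).
by apply: filterS => y Py; apply: PA => i j; rewrite ord1; exact: Py.
Qed.

Lemma continuous_shear : continuous shear.
Proof.
move=> x; apply: continuous_row => -[[|[|[]]]// j].
- rewrite (_ : (fun y => _) = (fun y : 'rV[R]_3 => y 0 0 + y 0 1)); last first.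
    by apply/funext => y; rewrite mxE.
  by apply: (@continuousD R R 'rV[R]_3); exact: coord_continuous.
- rewrite (_ : (fun y => _) = (fun y : 'rV[R]_3 => y 0 2)); last first.
    by apply/funext => y; rewrite mxE.
  exact: coord_continuous.
Qed.

Lemma continuous_lift_phi (f : 'rV[R]_2 -> R) (x : 'rV[R]_3) :
  {for shear x, continuous f} -> {for x, continuous (lift_phi f)}.
Proof.
move=> cf; apply: (@continuous_comp _ _ _ shear f x _ cf).
exact: continuous_shear.
Qed.

Lemma open_slab n (j : 'I_n) (L1 L2 : R) : open (slab j L1 L2).
Proof.
have -> : slab j L1 L2 = (fun x : 'rV[R]_n => x 0 j) @^-1` `]L1, L2[%classic.
  by apply/seteqP; split => x; rewrite /slab /= in_itv.
by apply: open_comp => [x _|]; [exact: coord_continuous|exact: interval_open].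
Qed.

Lemma Ck_lift_phi (L1 L2 : R) k (f : 'rV[R]_2 -> R) :
  Ck k (slab 1 L1 L2) f -> Ck k (slab 2 L1 L2) (lift_phi f).
Proof.
have slabE (x : 'rV[R]_3) : slab 2 L1 L2 x -> slab 1 L1 L2 (shear x).
  by rewrite /slab /= mxE.
elim: k f => [|k IHk] f [cf df]; split=> //.
- by move=> x /slabE/cf; exact: continuous_lift_phi.
- by move=> x /slabE/cf; exact: continuous_lift_phi.
- move=> i; rewrite partial_lift_phi.
  have [dfi Cfi] := df (if i == 2 then 1 else 0).
  by split=> [x /slabE/dfi|]; [exact: derivable_lift_phi|exact: IHk].
Qed.

End Shear.

(** * Parallel shear flows and the static Euler equations *)

Section ShearFlow.
Context {R : realType}.

Lemma partial_cst n (i : 'I_n) (c : R) : partial i (cst c) = cst 0.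
Proof. by apply/funext => x; rewrite /partial derive_cst. Qed.

Lemma Ck_cst n k (U : set 'rV[R]_n) (c : R) : Ck k U (cst c).
Proof.
have cc c' : forall x, U x -> {for x, continuous (cst c' : 'rV[R]_n -> R)}.
  by move=> x _; exact: cst_continuous.
elim: k c => [|k IHk] c; first by split; first exact: cc.
split=> [|i]; first exact: cc.
by rewrite partial_cst; split=> // x _; exact: derivable_cst.
Qed.

Lemma partialN n (i : 'I_n) (f : 'rV[R]_n -> R) (x : 'rV[R]_n) :
  derivable f x (delta_mx 0 i) -> partial i (- f) x = - partial i f x.
Proof. by move=> df; rewrite /partial deriveN. Qed.

(** The point is the continuity of [partial i (- f)]: this function is known to
    be [- partial i f] only where [f] is derivable, that is on [U], and openness
    of [U] turns this into an equality near each point of [U]. *)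
Lemma C1N n (U : set 'rV[R]_n) (f : 'rV[R]_n -> R) :
  open U -> Ck 1 U f -> Ck 1 U (- f).
Proof.
move=> oU [cf df]; split=> [x Ux|i]; first by apply: continuousN; exact: cf.
have [dfi [cdf _]] := df i.
have dN x : U x -> partial i (- f) x = - partial i f x by move=> /dfi/partialN.
split; first by move=> x /dfi; exact: derivableN.
split=> // x Ux; have xU : nbhs x U by exact: open_nbhs_nbhs.
have fx : Filter (nbhs x) by exact: nbhs_filter.
have cN : - partial i f @ x --> partial i (- f) x.
  by rewrite dN//; exact: continuousN (cdf x Ux).
apply: cvg_trans cN; apply: (@near_eq_cvg _ _ _ fx).
by apply: (@filterS _ _ fx _ _ _ xU) => y Uy; rewrite dN.
Qed.

Lemma sum_I3 (F : 'I_3 -> R) : \sum_(i < 3) F i = F 0 + F 1 + F 2.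
Proof.
rewrite !big_ord_recr big_ord0/= add0r.
by congr (F _ + F _ + F _); apply/val_inj.
Qed.

Definition shear_flow (p : 'rV[R]_2 -> R) (x : 'rV[R]_3) : 'rV[R]_3 :=
  vec3 (- lift_phi p x) (lift_phi p x) 0.

Lemma u_ppE (phi : 'rV[R]_2 -> R) : u_pp phi = shear_flow (partial 0 phi).
Proof. by apply/funext => x; rewrite /u_pp !partial_lift_phi. Qed.

Lemma component_shear_flow (p : 'rV[R]_2 -> R) :
  [/\ component (shear_flow p) 0 = - lift_phi p,
      component (shear_flow p) 1 = lift_phi p &
      component (shear_flow p) 2 = cst 0].
Proof. by split; apply/funext => x; rewrite /component mxE. Qed.

(** Both the advection and the divergence reduce to the difference of [d_1 g]
    and [d_2 g], where [g = lift_phi p], and these two derivatives agree. *)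
Lemma static_euler_shear_flow (L1 L2 : R) (p : 'rV[R]_2 -> R) :
  Ck 1 (slab 1 L1 L2) p ->
  static_euler (slab 2 L1 L2) (shear_flow p) (cst 0).
Proof.
move=> /Ck_lift_phi Cp; have [c0 c1 c2] := component_shear_flow p.
have dp x (i : 'I_3) :
    slab 2 L1 L2 x -> derivable (lift_phi p) x (delta_mx 0 i).
  by case: Cp => _ /(_ i)[dpi _]; exact: dpi.
have p01 : partial 1 (lift_phi p) = partial 0 (lift_phi p).
  by rewrite !partial_lift_phi.
have I3 (i : 'I_3) : [\/ i = 0, i = 1 | i = 2].
  by case: i => -[|[|[|[]]]]// i; [apply: Or31|apply: Or32|apply: Or33];
     apply/val_inj.
split.
- by move=> i; have [] := I3 i => ->; rewrite (c0, c1, c2);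
    [exact: C1N (open_slab _ _ _ _) Cp|exact: Cp|exact: Ck_cst].
- exact: Ck_cst.
- move=> x Ux; apply/rowP => i.
  rewrite !mxE partial_cst addr0 sum_I3 !mxE/= mul0r addr0 mulNr.
  have [] := I3 i => ->; rewrite (c0, c1, c2).
  + by rewrite !partialN ?p01 ?subrr//; [ring|exact: dp..].
  + by rewrite p01; ring.
  + by rewrite !partial_cst; ring.
- move=> x Ux; rewrite /divergence sum_I3 c0 c1 c2 partialN; last exact: dp.
  by rewrite p01 partial_cst addr0 addNr.
Qed.

Lemma boundary_condition_shear_flow (L1 L2 : R) (p : 'rV[R]_2 -> R) :
  (forall xi eta : R, L1 < eta < L2 ->
     p (vec2 (xi + 2 * pi) eta) = p (vec2 xi eta)) ->
  boundary_condition L1 L2 (shear_flow p).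
Proof.
move=> pp; have [_ _ c2] := component_shear_flow p.
split=> [x1 x2 x3 x3L|x1 x2 x3 x3L|x1 x2|x1 x2].
- by rewrite /shear_flow /lift_phi !mxE/= addrAC pp.
- by rewrite /shear_flow /lift_phi !mxE/= addrA pp.
- by rewrite c2; exact: cvg_cst.
- by rewrite c2; exact: cvg_cst.
Qed.

(** Moving along the first direction does not change [eta], so the difference
    quotients at the two points only involve points of the slab. *)
Lemma partial0_periodic (L1 L2 T : R) (f : 'rV[R]_2 -> R) :
  (forall xi eta : R, L1 < eta < L2 ->
     f (vec2 (xi + T) eta) = f (vec2 xi eta)) ->
  forall xi eta : R, L1 < eta < L2 ->
    partial 0 f (vec2 (xi + T) eta) = partial 0 f (vec2 xi eta).
Proof.
move=> pf xi eta etaL; apply: derive_along => h.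
have e0 (z : R) : h *: delta_mx 0 0 + vec2 z eta = vec2 (h + z) eta.
  by apply/rowP => -[[|[|[]]]// j]; rewrite !mxE/=; ring.
by rewrite !e0 addrA pf.
Qed.

Lemma euler_slab_solution_u_pp (L1 L2 : R) (phi : 'rV[R]_2 -> R) :
  Ck 2 (slab 1 L1 L2) phi ->
  (forall xi eta : R, L1 < eta < L2 ->
     phi (vec2 (xi + 2 * pi) eta) = phi (vec2 xi eta)) ->
  euler_slab_solution L1 L2 (u_pp phi).
Proof.
move=> [_ /(_ 0)[_ C1]] pphi; rewrite u_ppE; split.
  by exists (cst 0); exact: static_euler_shear_flow.
by apply: boundary_condition_shear_flow; exact: partial0_periodic.
Qed.

Lemma curl_shear_flow (p : 'rV[R]_2 -> R) (x : 'rV[R]_3) :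
  (forall i : 'I_3, derivable (lift_phi p) x (delta_mx 0 i)) ->
  curl (shear_flow p) x =
  vec3 (- partial 2 (lift_phi p) x) (- partial 2 (lift_phi p) x)
       (partial 0 (lift_phi p) x + partial 1 (lift_phi p) x).
Proof.
move=> dp; rewrite /curl; have [-> -> ->] := component_shear_flow p.
by rewrite !partial_cst !partialN//= opprK subr0 sub0r.
Qed.

Lemma dot_curl_shear_flow (p : 'rV[R]_2 -> R) (x : 'rV[R]_3) :
  (forall i : 'I_3, derivable (lift_phi p) x (delta_mx 0 i)) ->
  dot (curl (shear_flow p) x) (shear_flow p x) = 0.
Proof.
move=> dp; rewrite curl_shear_flow// /dot !big_ord_recl big_ord0 !mxE/=; ring.
Qed.

(** The curl of a shear flow produces [d_3 d_1] and [d_3 d_2] of the composite;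
    exchanging the two derivatives of [phi] gives the stated order. *)
Lemma curl_u_pp (L1 L2 : R) (phi : 'rV[R]_2 -> R) (x : 'rV[R]_3) :
  Ck 2 (slab 1 L1 L2) phi -> slab 2 L1 L2 x ->
  curl (u_pp phi) x =
  vec3 (- partial 0 (partial 2 (lift_phi phi)) x)
       (- partial 1 (partial 2 (lift_phi phi)) x)
       (partial 0 (partial 0 (lift_phi phi)) x +
        partial 1 (partial 1 (lift_phi phi)) x).
Proof.
move=> C2 Ux.
have Sx : slab 1 L1 L2 (shear x) by rewrite /slab/= mxE.
have [_ C] := C2; have [d0 [c0 dd0]] := C 0; have [d1 [c1 dd1]] := C 1.
have [d10 [c10 _]] := dd0 1; have [d01 [c01 _]] := dd1 0.
have swap : partial 1 (partial 0 phi) (shear x) =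
            partial 0 (partial 1 phi) (shear x).
  apply: (mixed_derivatives_commute _ _ _ _ (slab 1 L1 L2)).
  - by apply: open_nbhs_nbhs; split=> //; exact: open_slab.
  - by move=> y Uy; split; [exact: d0|exact: d1|exact: d10|exact: d01].
  - exact: c10.
  - exact: c01.
rewrite u_ppE curl_shear_flow; last first.
  move=> i; have [_ /(_ i)[dp _]] := Ck_lift_phi _ _ 1 _ (conj c0 dd0).
  exact: dp.
by rewrite !partial_lift_phi/= /lift_phi -/(shear x) swap.
Qed.

(** * Two distinct solutions *)

(** The span of [sin] and [cos] rather than [sin] alone: it is stable under both
    partial derivatives, which makes smoothness a plain induction. *)
Definition wave (a b : R) (z : 'rV[R]_2) : R :=
  a * sin (z 0 0) + b * cos (z 0 0).

Lemma is_derive_wave0 (a b : R) (z : 'rV[R]_2) :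
  is_derive z (delta_mx 0 0) (wave a b) (wave (- b) a z).
Proof.
have wl (h : R) : wave a b (h *: delta_mx 0 0 + z) =
    (a \*: @sin R + b \*: @cos R) (h *: 1 + z 0 0).
  by rewrite /wave !mxE/= mulr1 /GRing.scale/= mulr1.
have D : is_derive (z 0 0) 1 (a \*: @sin R + b \*: @cos R) (wave (- b) a z).
  have -> : wave (- b) a z = a *: cos (z 0 0) + b *: - sin (z 0 0).
    by rewrite /wave /GRing.scale/=; ring.
  exact: is_deriveD.
split; first by rewrite (derivable_along _ _ _ _ _ _ wl); case: D.
by rewrite (derive_along _ _ _ _ _ _ wl); case: D.
Qed.

Lemma is_derive_wave1 (a b : R) (z : 'rV[R]_2) :
  is_derive z (delta_mx 0 1) (wave a b) (wave 0 0 z).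
Proof.
have wl (h : R) : wave a b (h *: delta_mx 0 1 + z) =
    (cst (wave a b z) : R -> R) (h *: 1 + 0).
  by rewrite /wave !mxE/= mulr0 add0r.
split; first by rewrite (derivable_along _ _ _ _ _ _ wl); exact: derivable_cst.
by rewrite (derive_along _ _ _ _ _ _ wl) derive_cst /wave !mul0r addr0.
Qed.

Lemma smooth_wave (U : set 'rV[R]_2) (a b : R) : smooth U (wave a b).
Proof.
have wave_cont c d z : {for z, continuous (wave c d)}.
  apply: (@continuousD R R 'rV[R]_2); apply: (@continuousM R 'rV[R]_2);
    [exact: cst_continuous| |exact: cst_continuous|].
  - apply: (@continuous_comp 'rV[R]_2 R R (fun y => y 0 0)).
      exact: coord_continuous.
    exact: continuous_sin.
  - apply: (@continuous_comp 'rV[R]_2 R R (fun y => y 0 0)).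
      exact: coord_continuous.
    exact: continuous_cos.
move=> k; elim: k a b => [|k IHk] a b; first by split.
split=> [//|i]; have : i = 0 \/ i = 1.
  by case: i => -[|[|[]]]// i; [left|right]; apply/val_inj.
case=> ->; split=> [x _|].
- by have [] := is_derive_wave0 a b x.
- rewrite (_ : partial 0 _ = wave (- b) a); first exact: IHk.
  by apply/funext => x; have [_] := is_derive_wave0 a b x.
- by have [] := is_derive_wave1 a b x.
- rewrite (_ : partial 1 _ = wave 0 0); first exact: IHk.
  by apply/funext => x; have [_] := is_derive_wave1 a b x.
Qed.

Lemma wave_periodic (a b xi eta : R) :
  wave a b (vec2 (xi + 2 * pi) eta) = wave a b (vec2 xi eta).
Proof. by rewrite /wave !mxE/= mulr_natl sinD2pi cosD2pi. Qed.

Lemma u_pp_wave (a : R) (x : 'rV[R]_3) :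
  u_pp (wave a 0) x 0 1 = a * cos (x 0 0 + x 0 1).
Proof.
rewrite u_ppE /shear_flow mxE/= /lift_phi /partial.
have [_ ->] := is_derive_wave0 a 0 (vec2 (x 0 0 + x 0 1) (x 0 2)).
by rewrite /wave mxE/= oppr0 mul0r add0r.
Qed.

End ShearFlow.

Theorem theorem1p7 (R : realType) (L1 L2 : R) (hL : L1 < L2) :
  (forall phi : 'rV[R]_2 -> R,
     smooth (slab 1 L1 L2) phi ->
     (forall xi eta : R, L1 < eta < L2 ->
        phi (vec2 (xi + 2 * pi) eta) = phi (vec2 xi eta)) ->
     [/\ euler_slab_solution L1 L2 (u_pp phi),
         forall x : 'rV[R]_3, slab 2 L1 L2 x ->
           dot (curl (u_pp phi) x) (u_pp phi x) = 0 &
         forall x : 'rV[R]_3, slab 2 L1 L2 x ->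
           curl (u_pp phi) x =
           vec3 (- partial 0 (partial 2 (lift_phi phi)) x)
                (- partial 1 (partial 2 (lift_phi phi)) x)
                (partial 0 (partial 0 (lift_phi phi)) x +
                 partial 1 (partial 1 (lift_phi phi)) x)]) /\
  (exists u v : 'rV[R]_3 -> 'rV[R]_3,
     [/\ euler_slab_solution L1 L2 u,
         euler_slab_solution L1 L2 v &
         exists x : 'rV[R]_3, slab 2 L1 L2 x /\ u x <> v x]).
Proof.
split=> [phi /(_ 2%N) C2 pphi|].
  split=> [|x Ux|x Ux].
  - exact: euler_slab_solution_u_pp.
  - rewrite u_ppE; apply: dot_curl_shear_flow => i.
    have [_ /(_ 0)[_ C1]] := C2.
    by have [_ /(_ i)[dp _]] := Ck_lift_phi _ _ 1 _ C1; exact: dp.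
  - exact: curl_u_pp Ux.
have sol (a : R) : euler_slab_solution L1 L2 (u_pp (wave a 0)).
  apply: euler_slab_solution_u_pp => [|xi eta _]; first exact: smooth_wave.
  exact: wave_periodic.
(* The second velocity components are 0 and [cos (x_1 + x_2)]: they differ at
   [x_1 = x_2 = 0], here in the middle plane of the slab. *)
exists (u_pp (wave 0 0)), (u_pp (wave 1 0)); split=> //.
exists (vec3 0 0 ((L1 + L2) / 2)); split.
  by rewrite /slab/= mxE/= !midf_lt.
move=> /rowP/(_ 1); rewrite !u_pp_wave !mxE/= addr0 cos0 mul0r mulr1.
by move/eqP; rewrite eq_sym oner_eq0.
Qed.
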